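(* For every $U\in\mathcal{U}(d)$ and every anti-Hermitian $K$ ($K^\dagger=-K$) with $\|K\|_F=1$, $\Big|\frac{d}{dt}H_2(e^{tK}U)\Big|_{t=0}\Big|\le\frac{8}{\sqrt d}$.
   Context: On $\mathbb{C}^{d_L}$ let $Z|k\rangle=\omega^k|k\rangle$, $X|k\rangle=|k+1\rangle$ (mod $d_L$), $\omega=e^{2\pi i/d_L}$, $\tau=-e^{i\pi/d_L}$, $D_{(a_1,a_2)}=\tau^{a_1a_2}X^{a_1}Z^{a_2}$, and for $\mathbf a=\mathbf a_1\oplus\cdots\oplus\mathbf a_n\in\mathbb{Z}_{d_L}^{2n}$ let $D_{\mathbf a}=D_{\mathbf a_1}\otimes\cdots\otimes D_{\mathbf a_n}$ acting on $\mathbb{C}^d$, $d=d_L^n$. The 2-Clifford entropy of a unitary $U$ is $H_2(U)=1-\frac{1}{d^6}\sum_{\mathbf a,\mathbf b}\big|\operatorname{tr}(D_{\mathbf a}^\dagger UD_{\mathbf b}U^\dagger)\big|^4$. $\|K\|_F=\sqrt{\operatorname{tr}(K^\dagger K)}$. *)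

(* Defs.v *)
From HB Require Import structures.
From mathcomp Require Import all_boot all_order all_algebra.
From mathcomp Require Import all_classical all_reals all_analysis.
From mathcomp Require Import complex.
Set Implicit Arguments. Unset Strict Implicit. Unset Printing Implicit Defensive.
Import Order.TTheory GRing.Theory Num.Theory.
Import numFieldNormedType.Exports.
Local Open Scope ring_scope.
Local Open Scope complex_scope.

Section Defs.
Variable R : realType.
Local Notation C := R[i].

Definition adj m (A : 'M[C]_m) : 'M[C]_m := (map_mx Num.conj A)^T.

(* Frobenius norm ||K||_F = sqrt(Re tr(K^dagger K)) (tr(K^dagger K) is real >= 0) *)
Definition frob m (K : 'M[C]_m) : R := Num.sqrt (complex.Re (\tr (adj K *m K))).

Definition mexp_partial m (A : 'M[C]_m) (N : nat) : 'M[C]_m :=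
  \sum_(k < N) (k`!%:R)^-1 *: (A ^+ k).
Definition mexp m (A : 'M[C]_m) : 'M[C]_m :=
  \matrix_(i, j)
    ((limn (fun N => complex.Re (mexp_partial A N i j))) +i*
     (limn (fun N => complex.Im (mexp_partial A N i j)))).

Definition omega (dL : nat) : C :=
  cos (2 * pi / dL%:R) +i* sin (2 * pi / dL%:R).
Definition tau (dL : nat) : C :=
  - (cos (pi / dL%:R) +i* sin (pi / dL%:R)).

(* The computational basis of C^d, d = dL^n, is indexed by 'I_(dL^n);
   the basis vector |x> is |k_0> (x) ... (x) |k_{n-1}> where k_j is the
   j-th base-dL digit of x. *)
Definition digit (dL : nat) (x : nat) (j : nat) : nat := ((x %/ dL ^ j) %% dL)%N.

(* a = a_1 (+) ... (+) a_n in Z_dL^{2n}, a_j = (a1 j, a2 j).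
   D_a = (x)_j tau^{a1 a2} X^{a1} Z^{a2}, with
   <x| tau^{a1 a2} X^{a1} Z^{a2} |y> = tau^{a1 a2} omega^{a2 y} [x = y + a1 mod dL]. *)
Definition Dop (dL n : nat) (a : {ffun 'I_n -> 'I_dL} * {ffun 'I_n -> 'I_dL})
  : 'M[C]_(dL ^ n) :=
  \matrix_(x, y)
    \prod_(j < n)
      ((digit dL x j == (digit dL y j + a.1 j) %% dL)%N%:R
        * tau dL ^+ (a.1 j * a.2 j)%N * omega dL ^+ (a.2 j * digit dL y j)%N).

Definition H2 (dL n : nat) (U : 'M[C]_(dL ^ n)) : R :=
  1 - ((dL ^ n)%N%:R ^+ 6)^-1 *
      \sum_(a : {ffun 'I_n -> 'I_dL} * {ffun 'I_n -> 'I_dL})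
      \sum_(b : {ffun 'I_n -> 'I_dL} * {ffun 'I_n -> 'I_dL})
        complex.Re (`|\tr (adj (Dop a) *m U *m Dop b *m adj U)| ^+ 4).

End Defs.

(* Main.v *)
(* Write d for the dimension and B_b = U D_b U^dagger, a unitary. The derivative
   of c_ab = tr(D_a^dagger e^{tK} B_b e^{-tK}) at t = 0 is
   c'_ab = tr(D_a^dagger (K B_b + B_b K^dagger)). The D_a are orthogonal of squared
   norm d, so Parseval gives sum_a |c_ab|^2 = d ||B_b||^2 = d^2, hence also
   |c_ab| <= d, and sum_a |c'_ab|^2 <= d (||K B_b|| + ||B_b K^dagger||)^2 <= 4 d.
   Since the derivative of |c_ab|^4 is at most 4 |c_ab|^3 |c'_ab| <= 4 d^2 |c_ab| |c'_ab|,
   a weighted AM-GM bounds its sum over a by 8 d^{7/2}; summing over the d^2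
   labels b and dividing by d^6 leaves 8 / sqrt d. *)
Require Import Defs.
From HB Require Import structures.
From mathcomp Require Import all_boot all_order all_algebra.
From mathcomp Require Import all_classical all_reals all_analysis.
From mathcomp Require Import complex ring lra.
Import Order.TTheory GRing.Theory Num.Theory.
Import numFieldNormedType.Exports.
Local Open Scope ring_scope.
Local Open Scope complex_scope.
Set Implicit Arguments. Unset Strict Implicit. Unset Printing Implicit Defensive.

(** * Power series with exponentially bounded coefficients *)

(** Absolute convergence by comparison with [A] times the series of exp(|M| |x|). *)
Lemma is_cvg_pseries_expbound (R : realType) (c : nat -> R) (A M x : R) :
  (forall n, `|c n| <= A * M ^+ n / n`!%:R) -> cvgn (pseries c x).
Proof.
move=> cb; apply: normed_cvg.
have A0 : 0 <= A.
  by have := le_trans (normr_ge0 _) (cb 0%N); rewrite expr0 mulr1 fact0 divr1.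
apply: (@series_le_cvg _ _ (fun n => A * exp_coeff (`|M| * `|x|) n)).
- by move=> n; exact: normr_ge0.
- by move=> n; rewrite mulr_ge0 // exp_coeff_ge0 // mulr_ge0.
- move=> n /=; rewrite /exp_coeff /= normrM normrX exprMn.
  rewrite (mulrC (_ * _) _^-1) mulrA mulrA ler_wpM2r ?exprn_ge0 //.
  apply: le_trans (cb n) _; rewrite mulrAC.
  rewrite mulrA ler_wpM2l ?divr_ge0 //.
  by rewrite (le_trans (ler_norm _)) // normrX.
- have -> : (fun n => A * exp_coeff (`|M| * `|x|) n) = A *: exp_coeff (`|M| * `|x|) by [].
  apply: is_cvg_seriesZ; exact: is_cvg_series_exp_coeff.
Qed.

(** The factor n+1 from differentiation cancels against (n+1)!, so the bound keeps its shape with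
    [A] replaced by [A * M] and can be iterated. *)
Lemma pseries_diffs_expbound (R : realType) (c : nat -> R) (A M : R) :
  (forall n, `|c n| <= A * M ^+ n / n`!%:R) ->
  forall n, `|pseries_diffs c n| <= (A * M) * M ^+ n / n`!%:R.
Proof.
move=> cb n; rewrite /pseries_diffs normrM ger0_norm //.
apply: le_trans (ler_wpM2l _ (cb n.+1)) _ => //.
rewrite factS natrM exprS invfM.
rewrite le_eqVlt; apply/orP; left; apply/eqP.
have h1 : n.+1%:R != 0 :> R by rewrite pnatr_eq0.
have h2 : n`!%:R != 0 :> R by rewrite pnatr_eq0 -lt0n fact_gt0.
by field; rewrite nat1r h1 h2.
Qed.

Lemma is_derive_pseries0 (R : realType) (c : nat -> R) (A M : R) :
  (forall n, `|c n| <= A * M ^+ n / n`!%:R) ->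
  is_derive (0 : R) (1 : R) (fun t => limn (pseries c t)) (c 1%N).
Proof.
move=> cb.
have -> : c 1%N = limn (pseries (pseries_diffs c) 0).
  (* The partial sum of index 0 is empty; from index 1 on, only the constant term survives at the
     point 0. *)
  apply/esym/cvg_lim => //; rewrite -cvg_shiftS.
  have -> : [sequence pseries (pseries_diffs c) 0 n.+1]_n = cst (c 1%N).
    apply/funext => n; rewrite /= /pseries /series /= big_nat_recl // big1 ?addr0.
      by rewrite expr0 mulr1 /pseries_diffs mul1r.
    by move=> i _; rewrite expr0n mulr0.
  exact: cvg_cst.
have cb1 := pseries_diffs_expbound cb.
have cb2 := pseries_diffs_expbound cb1.
(* Termwise differentiation needs convergence of the series and of its first two formal derivatives
   at some point of modulus greater than |0|; the point 1 is chosen. *)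
apply: (@pseries_snd_diffs _ _ 1).
- exact: is_cvg_pseries_expbound cb.
- exact: is_cvg_pseries_expbound cb1.
- exact: is_cvg_pseries_expbound cb2.
- by rewrite normr0 normr1.
Qed.

(** * Derivatives at 0 of complex-valued and matrix-valued functions of a real variable *)

Definition cderive (R : realType) (F : R -> R[i]) (l : R[i]) : Prop :=
  is_derive (0 : R) (1 : R) (fun t => complex.Re (F t)) (complex.Re l) /\
  is_derive (0 : R) (1 : R) (fun t => complex.Im (F t)) (complex.Im l).

Section CDerive.
Variable R : realType.
Implicit Types (F G : R -> R[i]) (l : R[i]).

Lemma cderive_cst l : cderive (fun=> l) 0.
Proof. by split; exact: is_derive_cst. Qed.

Lemma cderiveD F G l m : cderive F l -> cderive G m ->
  cderive (fun t => F t + G t) (l + m).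
Proof.
move=> [F1 F2] [G1 G2]; split; rewrite raddfD.
- have -> : (fun t => complex.Re (F t + G t)) =
    (fun t => complex.Re (F t)) + (fun t => complex.Re (G t)).
    by apply/funext => t; rewrite raddfD.
  exact: is_deriveD.
- have -> : (fun t => complex.Im (F t + G t)) =
    (fun t => complex.Im (F t)) + (fun t => complex.Im (G t)).
    by apply/funext => t; rewrite raddfD.
  exact: is_deriveD.
Qed.

Lemma cderiveM F G l m : cderive F l -> cderive G m ->
  cderive (fun t => F t * G t) (l * G 0 + F 0 * m).
Proof.
move=> [F1 F2] [G1 G2]; split.
- have -> : (fun t => complex.Re (F t * G t)) =
    (fun t => complex.Re (F t)) * (fun t => complex.Re (G t)) -
    (fun t => complex.Im (F t)) * (fun t => complex.Im (G t)).
    by apply/funext => t; rewrite !fctE; case: (F t) (G t) => [a b] [c d].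
  apply: is_derive_eq; case: l m (F 0) (G 0) {F1 F2 G1 G2} => [a b] [c d] [e f] [g h] /=.
  by rewrite /GRing.scale /=; ring.
- have -> : (fun t => complex.Im (F t * G t)) =
    (fun t => complex.Re (F t)) * (fun t => complex.Im (G t)) +
    (fun t => complex.Im (F t)) * (fun t => complex.Re (G t)).
    by apply/funext => t; rewrite !fctE; case: (F t) (G t) => [a b] [c d].
  apply: is_derive_eq; case: l m (F 0) (G 0) {F1 F2 G1 G2} => [a b] [c d] [e f] [g h] /=.
  by rewrite /GRing.scale /=; ring.
Qed.

Lemma cderive_conj F l : cderive F l -> cderive (fun t => (F t)^*) l^*.
Proof.
move=> [F1 F2]; split.
- have -> : (fun t => complex.Re (F t)^*) = (fun t => complex.Re (F t)).
    by apply/funext => t; case: (F t).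
  by case: l F1 F2 => a b F1 F2; exact: F1.
- have -> : (fun t => @complex.Im R (F t)^*) = - (fun t => complex.Im (F t)).
    by apply/funext => t; rewrite !fctE; case: (F t).
  by case: l F1 F2 => a b F1 F2; exact: is_deriveN.
Qed.

Lemma cderive_sum (I : Type) (r : seq I) (F : I -> R -> R[i]) (l : I -> R[i]) :
  (forall i, cderive (F i) (l i)) ->
  cderive (fun t => \sum_(i <- r) F i t) (\sum_(i <- r) l i).
Proof.
move=> dF; elim: r => [|i r IH].
  rewrite big_nil (_ : (fun _ => _) = (fun=> 0)); first exact: cderive_cst.
  by apply/funext => t; rewrite big_nil.
rewrite big_cons (_ : (fun t => \sum_(_ <- i :: _) _) =
  (fun t => F i t + \sum_(i <- r) F i t)); last by apply/funext => t; rewrite big_cons.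
exact: cderiveD.
Qed.

(** Writing |F|^4 as a polynomial in the real and imaginary parts avoids differentiating the
    modulus, which need not be smooth where F vanishes. *)
Lemma is_derive_sqnorm2 F l : cderive F l ->
  is_derive (0 : R) (1 : R)
    (fun t => (complex.Re (F t) ^+ 2 + complex.Im (F t) ^+ 2) ^+ 2)
    (4 * (complex.Re (F 0) ^+ 2 + complex.Im (F 0) ^+ 2) *
      (complex.Re (F 0) * complex.Re l + complex.Im (F 0) * complex.Im l)).
Proof.
move=> [F1 F2].
have -> : (fun t => (complex.Re (F t) ^+ 2 + complex.Im (F t) ^+ 2) ^+ 2) =
  ((fun t => complex.Re (F t)) ^+ 2 + (fun t => complex.Im (F t)) ^+ 2) ^+ 2.
  by [].
apply: is_derive_eq.
by rewrite /GRing.scale /= !fctE; ring.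
Qed.

Definition mderive m n (F : R -> 'M[R[i]]_(m, n)) (L : 'M[R[i]]_(m, n)) : Prop :=
  forall i j, cderive (fun t => F t i j) (L i j).

Lemma mderive_cst m n (L : 'M[R[i]]_(m, n)) : mderive (fun=> L) 0.
Proof. by move=> i j; rewrite mxE; exact: cderive_cst. Qed.

Lemma mderiveM m n p (F : R -> 'M[R[i]]_(m, n)) (G : R -> 'M[R[i]]_(n, p)) L M :
  mderive F L -> mderive G M ->
  mderive (fun t => F t *m G t) (L *m G 0 + F 0 *m M).
Proof.
move=> dF dG i j; rewrite !mxE -big_split /=.
rewrite (_ : (fun t => _) = (fun t => \sum_k F t i k * G t k j)).
  by apply: cderive_sum => k; apply: cderiveM.
by apply/funext => t; rewrite mxE.
Qed.

Lemma mderive_adj n (F : R -> 'M[R[i]]_n) L :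
  mderive F L -> mderive (fun t => adj (F t)) (adj L).
Proof.
move=> dF i j; rewrite !mxE.
rewrite (_ : (fun t => _) = (fun t => (F t j i)^*)); last first.
  by apply/funext => t; rewrite !mxE.
exact: cderive_conj.
Qed.

Lemma cderive_trace n (F : R -> 'M[R[i]]_n) L :
  mderive F L -> cderive (fun t => \tr (F t)) (\tr L).
Proof. by move=> dF; apply: cderive_sum. Qed.

End CDerive.

(** * The matrix exponential near 0 *)

Lemma expmxZ (R : comPzRingType) m (a : R) (A : 'M[R]_m) k :
  (a *: A) ^+ k = a ^+ k *: A ^+ k.
Proof.
elim: k => [|k IH]; first by rewrite !expr0 scale1r.
rewrite !exprS IH -[LHS]/((a *: A) *m (a ^+ k *: A ^+ k)).
by rewrite -scalemxAl -scalemxAr scalerA.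
Qed.

Lemma ler_norm_ReIm (R : realType) (z : R[i]) :
  `|complex.Re z| <= complex.Re `|z| /\ `|complex.Im z| <= complex.Re `|z|.
Proof.
rewrite normc_def; case: z => a b /=; rewrite -!sqrtr_sqr; split; apply: ler_wsqrtr.
  by rewrite lerDl sqr_ge0.
by rewrite lerDr sqr_ge0.
Qed.

(** Induction on [k]: each row sum of moduli is at most the sum over all entries, so one more
    multiplication by [A] costs at most one more factor. *)
Lemma norm_expmx_le (R : realType) m (A : 'M[R[i]]_m) (k : nat) i j :
  `|(A ^+ k) i j| <= (1 + \sum_p \sum_q `|A p q|) ^+ k.
Proof.
set S := \sum_p \sum_q _.
have S0 : 0 <= S by apply: sumr_ge0 => p _; apply: sumr_ge0.
elim: k i j => [|k IH] i j.
  by rewrite !expr0 mxE; case: (i == j); rewrite ?normr1 ?normr0.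
rewrite exprS mxE (le_trans (ler_norm_sum _ _ _)) //.
apply: (@le_trans _ _ (\sum_q `|A i q| * (1 + S) ^+ k)).
  by apply: ler_sum => q _; rewrite normrM ler_wpM2l.
rewrite -mulr_suml exprS ler_wpM2r ?exprn_ge0 ?addr_ge0 //.
rewrite ler_wpDl // /S [leRHS](bigD1 i) //= lerDl.
by apply: sumr_ge0 => p _; apply: sumr_ge0.
Qed.

(** Brings both coefficient sequences of an entry of the exponential into the shape asked for by
    [is_derive_pseries0], with [A] there equal to 1. *)
Lemma expmx_coef_bound (R : realType) m (A : 'M[R[i]]_m) i j :
  exists M : R, forall k,
    `|complex.Re ((A ^+ k) i j) / k`!%:R| <= 1 * M ^+ k / k`!%:R /\
    `|complex.Im ((A ^+ k) i j) / k`!%:R| <= 1 * M ^+ k / k`!%:R.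
Proof.
exists (1 + \sum_p \sum_q complex.Re `|A p q|) => k.
have := @norm_expmx_le R m A k i j.
(* The bound is rewritten as the image of a real number, so that the inequality in [R[i]] descends
   to [R]. *)
have -> : (1 + \sum_p \sum_q `|A p q|) ^+ k =
   ((1 + \sum_p \sum_q complex.Re `|A p q|) ^+ k)%:C.
  rewrite rmorphXn rmorphD rmorph1 rmorph_sum; congr ((_ + _) ^+ _).
  apply: eq_bigr => p _; rewrite rmorph_sum; apply: eq_bigr => q _.
  by rewrite normc_def.
rewrite normc_def lecR -[Num.sqrt _]/(complex.Re (Num.sqrt _)%:C) -normc_def => le_k; have [leRe leIm] := ler_norm_ReIm ((A ^+ k) i j).
rewrite mul1r !normrM normfV (ger0_norm (ler0n _ _)).
by split; apply: ler_wpM2r; rewrite ?invr_ge0 // (le_trans _ le_k).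
Qed.

Lemma mexp_partial_entry (R : realType) m (A : 'M[R[i]]_m) (t : R) N i j :
  mexp_partial (t%:C *: A) N i j =
  \sum_(0 <= k < N) ((k`!%:R)^-1 * t ^+ k)%:C * (A ^+ k) i j.
Proof.
rewrite /mexp_partial summxE big_mkord; apply: eq_bigr => k _.
rewrite expmxZ !mxE mulrA; congr (_ * _).
by rewrite rmorphM rmorphXn fmorphV rmorph_nat.
Qed.

(** The real and imaginary parts of each entry are real power series in t; the derivative at 0 is
    their coefficient of index 1, which comes from [A ^+ 1]. *)
Lemma mderive_mexp (R : realType) m (A : 'M[R[i]]_m) :
  mderive (fun t => mexp (t%:C *: A)) A.
Proof.
move=> i j; have [M Mb] := @expmx_coef_bound R m A i j.
split.
- rewrite (_ : (fun t => _) =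
    (fun t => limn (pseries (fun k => complex.Re ((A ^+ k) i j) / k`!%:R) t))).
    rewrite (_ : complex.Re (A i j) = complex.Re ((A ^+ 1) i j) / 1`!%:R).
      exact: is_derive_pseries0 (fun k => (Mb k).1).
    by rewrite expr1 divr1.
  apply/funext => t; rewrite mxE /=; congr (limn _); apply/funext => N.
  rewrite mexp_partial_entry raddf_sum; apply: eq_bigr => k _.
  by rewrite /=; case: ((A ^+ k) i j) => a b /=; ring.
- rewrite (_ : (fun t => _) =
    (fun t => limn (pseries (fun k => complex.Im ((A ^+ k) i j) / k`!%:R) t))).
    rewrite (_ : complex.Im (A i j) = complex.Im ((A ^+ 1) i j) / 1`!%:R).
      exact: is_derive_pseries0 (fun k => (Mb k).2).
    by rewrite expr1 divr1.
  apply/funext => t; rewrite mxE /=; congr (limn _); apply/funext => N.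
  rewrite mexp_partial_entry raddf_sum; apply: eq_bigr => k _.
  by rewrite /=; case: ((A ^+ k) i j) => a b /=; ring.
Qed.

Lemma mexp0 (R : realType) m : mexp (0 : 'M[R[i]]_m) = 1%:M.
Proof.
apply/matrixP => i j; rewrite mxE.
have lim1 N : mexp_partial (0 : 'M[R[i]]_m) N.+1 = 1%:M.
  rewrite /mexp_partial big_ord_recl big1 ?addr0 ?expr0 ?fact0 ?invr1 ?scale1r //.
  by move=> k _; rewrite expr0n scaler0.
rewrite [X in X +i* _](_ : _ = complex.Re ((1%:M : 'M[R[i]]_m) i j)).
  rewrite [X in _ +i* X](_ : _ = complex.Im ((1%:M : 'M[R[i]]_m) i j)).
    by case: (1%:M i j).
  apply/cvg_lim => //; rewrite -cvg_shiftS /=.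
  by under eq_fun do rewrite lim1; exact: cvg_cst.
apply/cvg_lim => //; rewrite -cvg_shiftS /=.
by under eq_fun do rewrite lim1; exact: cvg_cst.
Qed.

(** * Weyl operators on a single qudit *)

Section SingleQudit.
Variables (R : realType) (dL : nat).
Hypothesis dL_gt0 : (0 < dL)%N.
Local Notation C := R[i].

Lemma cis_exp (x : R) k :
  (cos x +i* sin x) ^+ k = cos (k%:R * x) +i* sin (k%:R * x) :> C.
Proof.
elim: k => [|k IH]; first by rewrite expr0 mul0r cos0 sin0.
rewrite exprS IH -nat1r mulrDl mul1r cosD sinD; apply/eqP; rewrite eq_complex /=.
by rewrite eqxx /= addrC.
Qed.

Lemma mul_conj_cis (x : R) : (cos x +i* sin x)^* * (cos x +i* sin x) = 1 :> C.
Proof.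
apply/eqP; rewrite eq_complex /= mulNr opprK -!expr2 cos2Dsin2 eqxx /=.
by rewrite mulrC mulNr subrr.
Qed.

Lemma mul_conj_tau : (tau R dL)^* * tau R dL = 1.
Proof. by rewrite /tau rmorphN mulrNN mul_conj_cis. Qed.

Lemma mul_conj_omega : (omega R dL)^* * omega R dL = 1.
Proof. exact: mul_conj_cis. Qed.

Lemma omega_exp_dL : omega R dL ^+ dL = 1.
Proof.
rewrite cis_exp mulrC divfK ?pnatr_eq0 -?lt0n //.
by rewrite mulr_natl cos2pi sin2pi.
Qed.

(** The real part is cos(2x) = 1 - 2 sin(x)^2 with x = k pi / dL strictly between 0 and pi, hence
    less than 1. *)
Lemma omega_exp_neq1 k : (0 < k < dL)%N -> omega R dL ^+ k != 1.
Proof.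
move=> /andP[k0 kd]; rewrite cis_exp eq_complex /= negb_and; apply/orP; left.
rewrite (_ : _ * _ = (k%:R * pi / dL%:R) *+ 2); last by rewrite -mulr_natl; ring.
rewrite cos_mulr2n cos2sin2 lt_eqF // mulrnBl.
have : 0 < sin (k%:R * pi / dL%:R) :> R.
  apply: sin_gt0_pi; rewrite divr_gt0 ?mulr_gt0 ?ltr0n ?pi_gt0 //=.
  by rewrite ltr_pdivrMr ?ltr0n // mulrC ltr_pM2l ?pi_gt0 // ltr_nat.
by move=> s0; have := exprn_gt0 2 s0; lra.
Qed.

Lemma omega_orthogonality (l l' : 'I_dL) :
  \sum_(q < dL) (omega R dL ^+ (q * l))^* * omega R dL ^+ (q * l') =
  dL%:R * (l == l')%:R.
Proof.
have E m m' : (m <= m')%N -> (omega R dL ^+ m)^* * omega R dL ^+ m' =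
    omega R dL ^+ (m' - m).
  move=> le_m; rewrite -{1}(subnKC le_m) exprD mulrA rmorphXn -exprMn.
  by rewrite mul_conj_omega expr1n mul1r.
(* Geometric sum: its product with omega^k - 1 is omega^(k dL) - 1 = 0, and the first factor is
   nonzero. *)
have geo k : (0 < k < dL)%N -> \sum_(q < dL) omega R dL ^+ (q * k) = 0.
  move=> hk; have /eqP := subrX1 (omega R dL ^+ k) dL.
  rewrite -exprM mulnC exprM omega_exp_dL expr1n subrr eq_sym mulf_eq0.
  rewrite subr_eq0 (negPf (omega_exp_neq1 hk)) /= => /eqP sum0.
  by rewrite -[RHS]sum0; apply: eq_bigr => q _; rewrite mulnC exprM.
have [->|neq] := eqVneq l l'.
  rewrite mulr1 (eq_bigr (fun=> 1)) ?sumr_const ?card_ord //.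
  by move=> q _; rewrite E // subnn expr0.
rewrite mulr0; case: (ltngtP l l') => [lt|lt|/val_inj eq].
- rewrite -[RHS](geo (l' - l)%N) ?subn_gt0 ?lt /= ?(leq_ltn_trans (leq_subr _ _)) //.
  by apply: eq_bigr => q _; rewrite E ?leq_mul2l ?(ltnW lt) ?orbT // mulnBr.
(* Exponents are natural numbers, so the difference must be taken the other way round; conjugating
   the sum achieves this. *)
- apply: (can_inj (@conjcK R)); rewrite rmorph0.
  rewrite -[RHS](geo (l - l')%N) ?subn_gt0 ?lt /= ?(leq_ltn_trans (leq_subr _ _)) //.
  rewrite rmorph_sum; apply: eq_bigr => q _; rewrite rmorphM /= conjcK mulrC.
  by rewrite E ?leq_mul2l ?(ltnW lt) ?orbT // mulnBr.
- by rewrite eq eqxx in neq.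
Qed.

(* <k| tau^(pq) X^p Z^q |l> *)
Definition weyl_entry (p q k l : nat) : C :=
  (k == (l + p) %% dL)%N%:R * tau R dL ^+ (p * q)%N * omega R dL ^+ (q * l)%N.

(** Column l has a single nonzero entry, a phase in row l + p mod dL, and distinct columns have it
    in distinct rows. *)
Lemma weyl_entry_unitary p q (l l' : 'I_dL) :
  \sum_(k < dL) (weyl_entry p q k l)^* * weyl_entry p q k l' = (l == l')%:R.
Proof.
have ltm : ((l + p) %% dL < dL)%N by rewrite ltn_pmod.
rewrite (bigD1 (Ordinal ltm)) //= big1 ?addr0; last first.
  move=> k neq_k; rewrite /weyl_entry (_ : (k == _ :> nat)%N = false).
    by rewrite !mul0r rmorph0 mul0r.
  by apply: contraNF neq_k => /eqP kE; apply/eqP/val_inj.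
rewrite /weyl_entry eqxx eqn_modDr !modn_small // -val_eqE.
have [/val_inj ->|neq] := eqVneq (val l) (val l'); last by rewrite !mul0r mulr0.
rewrite !mul1r rmorphM mulrACA !rmorphXn -!exprMn.
by rewrite mul_conj_tau mul_conj_omega !expr1n mulr1.
Qed.

Lemma sum_shift_indicator (k l : 'I_dL) :
  \sum_(p < dL) (k == (l + p) %% dL :> nat)%N%:R = 1 :> C.
Proof.
(* The unique shift is p = k - l mod dL, written with dL - l to avoid truncated subtraction. *)
have ltm : ((k + (dL - l)) %% dL < dL)%N by rewrite ltn_pmod.
have ltl := ltn_ord l.
have kE : (k : nat) = ((l + (k + (dL - l)) %% dL) %% dL)%N.
  by rewrite modnDmr addnCA subnKC 1?ltnW // modnDr modn_small.
rewrite (bigD1 (Ordinal ltm)) //= -kE eqxx big1 ?addr0 // => p neq_p.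
rewrite (_ : (k == _ :> nat)%N = false) //; apply: contraNF neq_p.
rewrite {1}kE eqn_modDl modn_mod (modn_small (ltn_ord p)) => /eqP pE.
by apply/eqP/val_inj; rewrite /= pE.
Qed.

(** The tau phases cancel; the sum over q is Fourier orthogonality and forces l = l', after which
    the sum over the shift p forces k = k'. *)
Lemma weyl_entry_complete (k l k' l' : 'I_dL) :
  \sum_(p < dL) \sum_(q < dL)
    (weyl_entry p q k l)^* * weyl_entry p q k' l' =
  dL%:R * ((k == k') && (l == l'))%:R.
Proof.
transitivity (\sum_(p < dL) (k == (l + p) %% dL :> nat)%N%:R *
    (k' == (l' + p) %% dL :> nat)%N%:R * (dL%:R * (l == l')%:R) : C).
  apply: eq_bigr => p _; rewrite -omega_orthogonality mulr_sumr.
  apply: eq_bigr => q _; rewrite /weyl_entry !rmorphM rmorph_nat /=.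
  have aux (x y t t' z w : C) : t' * t = 1 -> x * t' * z * (y * t * w) = x * y * (z * w).
    by move=> tt; rewrite -[RHS]mulr1 -tt; ring.
  by apply: aux; rewrite rmorphXn -exprMn mul_conj_tau expr1n.
have [<-|neq] := eqVneq l l'; last by rewrite andbF mulr0 big1 // => p _; rewrite mulr0.
rewrite andbT mulr1 -mulr_suml mulrC; congr (_ * _).
have [<-|neq] := eqVneq k k'.
  rewrite -[RHS](sum_shift_indicator k l); apply: eq_bigr => p _.
  by case: (_ == _); rewrite ?mulr1 ?mulr0.
apply: big1 => p _; have [kE|_] := eqVneq (k : nat); last by rewrite mul0r.
by rewrite -kE eq_sym -val_eqE /= in neq *; rewrite (negPf neq) mulr0.
Qed.

End SingleQudit.

(** * Tensor products of Weyl operators and the Parseval identity *)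

(** Induction on n: the lowest digit gives the remainder mod dL, and the higher digits are those of
    the quotient. *)
Lemma digit_inj dL n x y : (0 < dL)%N -> (x < dL ^ n)%N -> (y < dL ^ n)%N ->
  (forall j, (j < n)%N -> digit dL x j = digit dL y j) -> x = y.
Proof.
move=> dL0; elim: n x y => [|n IH] x y; first by rewrite expn0 !ltnS !leqn0 => /eqP-> /eqP->.
rewrite expnSr => ltx lty eqd.
rewrite (divn_eq x dL) (divn_eq y dL); congr (_ * _ + _)%N.
  apply: IH; rewrite ?ltn_divLR // => j ltj; have := eqd j.+1 ltj.
  by rewrite /digit expnS !divnMA.
by have := eqd 0%N isT; rewrite /digit expn0 !divn1.
Qed.

Section Tensor.
Variables (R : realType) (dL n : nat).
Hypothesis dL_gt0 : (0 < dL)%N.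
Local Notation C := R[i].
Local Notation label := ({ffun 'I_n -> 'I_dL} * {ffun 'I_n -> 'I_dL})%type.

Definition digits (x : 'I_(dL ^ n)) : {ffun 'I_n -> 'I_dL} :=
  [ffun j : 'I_n => Ordinal (ltn_pmod (x %/ dL ^ j) dL_gt0)].

Lemma digits_inj : injective digits.
Proof.
move=> x y eqxy; apply/val_inj/(digit_inj dL_gt0 (ltn_ord x) (ltn_ord y)) => j ltj.
by have /ffunP/(_ (Ordinal ltj)) := eqxy; rewrite !ffunE => /(congr1 val).
Qed.

Lemma digits_bij : bijective digits.
Proof. by apply: inj_card_bij digits_inj _; rewrite card_ffun !card_ord. Qed.

Lemma DopE (a : label) x y :
  Dop R a x y = \prod_(j < n) weyl_entry R dL (a.1 j) (a.2 j) (digits x j) (digits y j).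
Proof. by rewrite mxE; apply: eq_bigr => j _; rewrite !ffunE. Qed.

Lemma prod_eq_indicator (f g : {ffun 'I_n -> 'I_dL}) :
  \prod_j (f j == g j)%:R = (f == g)%:R :> C.
Proof.
have [->|neq] := eqVneq f g; first by apply: big1 => j _; rewrite eqxx.
have /existsP[j neqj] : [exists j, f j != g j].
  apply: contraNT neq; rewrite negb_exists => /forallP eqfg.
  by apply/eqP/ffunP => j; apply/eqP; rewrite -[_ == _]negbK.
by rewrite (bigD1 j) //= (negPf neqj) mul0r.
Qed.

Lemma Dop_unitary (a : label) : adj (Dop R a) *m Dop R a = 1%:M.
Proof.
apply/matrixP => y y'; rewrite !mxE.
transitivity (\sum_x \prod_j ((weyl_entry R dL (a.1 j) (a.2 j) (digits x j) (digits y j))^* *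
    weyl_entry R dL (a.1 j) (a.2 j) (digits x j) (digits y' j))).
  by apply: eq_bigr => x _; rewrite big_split /= -rmorph_prod -!DopE !mxE.
(* Summing over digit tuples instead of [x] turns the sum of products into a product of single-site
   sums. *)
have [inv invK Kinv] := digits_bij.
rewrite (reindex inv) /=; last by exists digits => ? _; [exact: Kinv | exact: invK].
under eq_bigr do rewrite Kinv.
rewrite -(bigA_distr_bigA (fun (j : 'I_n) (k : 'I_dL) =>
  (weyl_entry R dL (a.1 j) (a.2 j) k (digits y j))^* *
    weyl_entry R dL (a.1 j) (a.2 j) k (digits y' j))) /=.
under eq_bigr do rewrite weyl_entry_unitary //.
by rewrite prod_eq_indicator (inj_eq digits_inj).
Qed.

(** Completeness, the dual form of the orthogonality of the D_a: the label sum factors over the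
    sites. This is the form that Parseval consumes. *)
Lemma Dop_complete x y x' y' :
  \sum_(a : label) (Dop R a x y)^* * Dop R a x' y' =
  (dL ^ n)%:R * ((x, y) == (x', y'))%:R.
Proof.
rewrite -(pair_bigA _ (fun a1 a2 : {ffun 'I_n -> 'I_dL} =>
   (Dop R (a1, a2) x y)^* * Dop R (a1, a2) x' y')) /=.
transitivity (\sum_(a1 : {ffun 'I_n -> 'I_dL}) \sum_(a2 : {ffun 'I_n -> 'I_dL}) \prod_j
   ((weyl_entry R dL (a1 j) (a2 j) (digits x j) (digits y j))^* *
    weyl_entry R dL (a1 j) (a2 j) (digits x' j) (digits y' j))).
  apply: eq_bigr => a1 _; apply: eq_bigr => a2 _.
  by rewrite !DopE rmorph_prod -big_split.
transitivity (\sum_(a1 : {ffun 'I_n -> 'I_dL}) \prod_j \sum_(q < dL)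
   ((weyl_entry R dL (a1 j) q (digits x j) (digits y j))^* *
    weyl_entry R dL (a1 j) q (digits x' j) (digits y' j))).
  by apply: eq_bigr => a1 _; rewrite bigA_distr_bigA.
rewrite -(bigA_distr_bigA (fun (j : 'I_n) (p : 'I_dL) => \sum_(q < dL)
   ((weyl_entry R dL p q (digits x j) (digits y j))^* *
    weyl_entry R dL p q (digits x' j) (digits y' j)))) /=.
under eq_bigr do rewrite weyl_entry_complete // -mulnb natrM.
rewrite !big_split /= !prod_eq_indicator !(inj_eq digits_inj) prodr_const card_ord.
by rewrite natrX xpair_eqE -mulnb natrM.
Qed.

(** Expand both traces over matrix entries and sum over the labels first: completeness leaves only
    the diagonal pairs of entries. *)
Lemma Dop_parseval (M : 'M[C]_(dL ^ n)) :
  \sum_(a : label) \tr (adj (Dop R a) *m M) * (\tr (adj (Dop R a) *m M))^* =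
  (dL ^ n)%:R * \tr (adj M *m M).
Proof.
have trE (A : 'M[C]_(dL ^ n)) : \tr (adj A *m M) = \sum_p (A p.1 p.2)^* * M p.1 p.2.
  rewrite -(pair_bigA _ (fun x y => (A x y)^* * M x y)) exchange_big /=.
  by apply: eq_bigr => y _; rewrite mxE; apply: eq_bigr => x _; rewrite !mxE.
rewrite trE mulr_sumr.
transitivity (\sum_(a : label) \sum_p \sum_p' (M p.1 p.2 * (M p'.1 p'.2)^*) *
    ((Dop R a p.1 p.2)^* * Dop R a p'.1 p'.2)).
  apply: eq_bigr => a _; rewrite trE rmorph_sum mulr_suml; apply: eq_bigr => p _.
  rewrite mulr_sumr; apply: eq_bigr => p' _; rewrite rmorphM /= conjCK; ring.
rewrite exchange_big; apply: eq_bigr => p _; rewrite exchange_big /=.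
transitivity (\sum_p' M p.1 p.2 * (M p'.1 p'.2)^* * ((dL ^ n)%:R * (p == p')%:R)).
  apply: eq_bigr => p' _; rewrite -mulr_sumr Dop_complete.
  by rewrite -!surjective_pairing.
rewrite (bigD1 p) //= [X in _ + X]big1 ?addr0; last first.
  by move=> p' neq; rewrite eq_sym (negPf neq) !mulr0.
by rewrite eqxx mulr1; ring.
Qed.

End Tensor.

(** * Frobenius norm estimates and the bound for a fixed label b *)

Section Bound.
Variable R : realType.
Local Notation C := R[i].

Definition sqnorm (z : C) : R := complex.Re z ^+ 2 + complex.Im z ^+ 2.

Lemma sqnormE (z : C) : (sqnorm z)%:C = z * z^*.
Proof. by rewrite add_Re2_Im2 sqr_normc. Qed.

Lemma sqnorm_ge0 (z : C) : 0 <= sqnorm z.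
Proof. by rewrite addr_ge0 ?sqr_ge0. Qed.

Definition frob2 m (A : 'M[C]_m) : R := complex.Re (\tr (adj A *m A)).

Lemma frob2E m (A : 'M[C]_m) : frob2 A = \sum_j \sum_i sqnorm (A i j).
Proof.
rewrite /frob2 raddf_sum; apply: eq_bigr => j _; rewrite mxE raddf_sum.
by apply: eq_bigr => i _; rewrite !mxE mulrC -[_ * _]sqnormE.
Qed.

Lemma frob2_ge0 m (A : 'M[C]_m) : 0 <= frob2 A.
Proof. by rewrite frob2E; do 2!apply: sumr_ge0 => ? _; exact: sqnorm_ge0. Qed.

Lemma adjM m (A B : 'M[C]_m) : adj (A *m B) = adj B *m adj A.
Proof. by rewrite /adj map_mxM trmx_mul. Qed.

Lemma adjK m (A : 'M[C]_m) : adj (adj A) = A.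
Proof. by apply/matrixP => i j; rewrite !mxE conjCK. Qed.

Lemma frob2_mull m (V A : 'M[C]_m) : adj V *m V = 1%:M -> frob2 (V *m A) = frob2 A.
Proof. by move=> uV; rewrite /frob2 adjM mulmxA -(mulmxA (adj A)) uV mulmx1. Qed.

Lemma frob2_adj m (A : 'M[C]_m) : frob2 (adj A) = frob2 A.
Proof. by rewrite /frob2 adjK mxtrace_mulC. Qed.

Lemma frob2_mulr m (V A : 'M[C]_m) : adj V *m V = 1%:M -> frob2 (A *m V) = frob2 A.
Proof.
move=> uV; rewrite -frob2_adj adjM frob2_mull ?frob2_adj //.
by rewrite adjK; exact: mulmx1C.
Qed.

(** Entrywise from |a - c|^2 >= 0; it stands in for the squared triangle inequality and loses
    nothing when both norms agree. *)
Lemma frob2_add_le m (A B : 'M[C]_m) : frob2 (A + B) <= 2 * (frob2 A + frob2 B).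
Proof.
rewrite !frob2E -big_split mulr_sumr /=; apply: ler_sum => j _.
rewrite -big_split mulr_sumr /=; apply: ler_sum => i _; rewrite mxE.
case: (A i j) (B i j) => [a b] [c d]; rewrite /sqnorm /=.
have := sqr_ge0 (a - c); have := sqr_ge0 (b - d); nra.
Qed.

Lemma frob2_unitary m (V : 'M[C]_m) : adj V *m V = 1%:M -> frob2 V = m%:R.
Proof. by move=> uV; rewrite /frob2 uV mxtrace1 raddfMn. Qed.

Lemma Dop_parseval_real dL n (dL_gt0 : (0 < dL)%N) (M : 'M[C]_(dL ^ n)) :
  \sum_(a : {ffun 'I_n -> 'I_dL} * {ffun 'I_n -> 'I_dL})
    sqnorm (\tr (adj (Dop R a) *m M)) = (dL ^ n)%:R * frob2 M.
Proof.
have ReMn k (x : C) : complex.Re (k%:R * x) = k%:R * complex.Re x.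
  by rewrite !mulr_natl raddfMn.
by rewrite /frob2 -ReMn -Dop_parseval // raddf_sum; apply: eq_bigr => a _; rewrite -[_ * _]sqnormE.
Qed.

(** Meant for r = sqrt d, where the hypothesis reads |z| <= d. The factor |z|^2 is replaced by r^4,
    and the remaining inner product is split into squares. *)
Lemma deriv_sqnorm2_bound (r : R) (z w : C) : 0 < r -> sqnorm z <= r ^+ 4 ->
  `|4 * sqnorm z * (complex.Re z * complex.Re w + complex.Im z * complex.Im w)| <=
  r ^+ 3 * (4 * sqnorm z + r ^+ 2 * sqnorm w).
Proof.
move=> r0 z_le; set x := _ + complex.Im z * _.
(* Weighted AM-GM; the weight r = sqrt d balances the two Parseval sums. *)
have young : 4 * r * `|x| <= 4 * sqnorm z + r ^+ 2 * sqnorm w.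
  rewrite /x /sqnorm; case: z w {x z_le} => [p q] [p' q'] /=.
  rewrite -(ger0_norm (_ : 0 <= 4 * r)) ?mulr_ge0 ?(ltW r0) // -normrM ler_norml.
  (* The two signs come from expanding |2z + r w|^2 >= 0 and |2z - r w|^2 >= 0. *)
  apply/andP; split.
  - by have := sqr_ge0 (2 * p + r * p'); have := sqr_ge0 (2 * q + r * q'); nra.
  - by have := sqr_ge0 (2 * p - r * p'); have := sqr_ge0 (2 * q - r * q'); nra.
rewrite normrM (ger0_norm (_ : 0 <= 4 * _)) ?mulr_ge0 ?sqnorm_ge0 //.
apply: le_trans (ler_wpM2l (exprn_ge0 3 (ltW r0)) young).
rewrite (_ : r ^+ 3 * _ = 4 * r ^+ 4 * `|x|); last by ring.
by rewrite ler_wpM2r // ler_wpM2l.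
Qed.

Lemma sum_deriv_bound dL n (dL_gt0 : (0 < dL)%N) (r : R) (K B : 'M[C]_(dL ^ n)) :
  0 < r -> r ^+ 2 = (dL ^ n)%:R -> frob2 K = 1 -> adj B *m B = 1%:M ->
  \sum_(a : {ffun 'I_n -> 'I_dL} * {ffun 'I_n -> 'I_dL})
    (let z := \tr (adj (Dop R a) *m B) in
     let w := \tr (adj (Dop R a) *m (K *m B + B *m adj K)) in
     `|4 * sqnorm z * (complex.Re z * complex.Re w + complex.Im z * complex.Im w)|) <=
  8 * r ^+ 7.
Proof.
move=> r0 r2 K1 uB.
have sumz := Dop_parseval_real dL_gt0 B; rewrite frob2_unitary // -r2 in sumz.
have sumw := Dop_parseval_real dL_gt0 (K *m B + B *m adj K); rewrite -r2 in sumw.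
(* Each of the two summands has squared norm 1, whence 2 (1 + 1) = 4. *)
have w_le : frob2 (K *m B + B *m adj K) <= 4.
  apply: le_trans (frob2_add_le _ _) _.
  by rewrite frob2_mulr // frob2_mull // frob2_adj K1; lra.
apply: (@le_trans _ _ (\sum_(a : {ffun 'I_n -> 'I_dL} * {ffun 'I_n -> 'I_dL})
   r ^+ 3 * (4 * sqnorm (\tr (adj (Dop R a) *m B)) +
    r ^+ 2 * sqnorm (\tr (adj (Dop R a) *m (K *m B + B *m adj K)))))).
  apply: ler_sum => a _; apply: deriv_sqnorm2_bound => //.
  (* A single term |z|^2 is at most the whole Parseval sum, which is d^2 = r^4. *)
  rewrite (_ : r ^+ 4 = r ^+ 2 * r ^+ 2); last by ring.
  rewrite -sumz (bigD1 a) //= lerDl; apply: sumr_ge0 => *; exact: sqnorm_ge0.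
rewrite -mulr_sumr big_split /= -!mulr_sumr sumz sumw.
rewrite (_ : 8 * r ^+ 7 = r ^+ 3 * (4 * (r ^+ 2 * r ^+ 2) + r ^+ 2 * (r ^+ 2 * 4))); last by ring.
by rewrite ler_wpM2l ?exprn_ge0 ?(ltW r0) // lerD2l !ler_wpM2l ?exprn_ge0 ?(ltW r0).
Qed.

End Bound.

(** * Differentiation of the entropy and the final estimate *)

Lemma is_derive_real_sum (R : realType) (I : Type) (r : seq I) (x : R)
    (F : I -> R -> R) (l : I -> R) :
  (forall i, is_derive x (1 : R) (F i) (l i)) ->
  is_derive x (1 : R) (fun t => \sum_(i <- r) F i t) (\sum_(i <- r) l i).
Proof.
move=> dF; elim: r => [|i r IH].
  rewrite big_nil (_ : (fun _ => _) = cst 0); first exact: is_derive_cst.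
  by apply/funext => t; rewrite big_nil.
rewrite big_cons (_ : (fun t => \sum_(_ <- i :: _) _) =
  F i + (fun t => \sum_(i <- r) F i t)); last by apply/funext => t; rewrite big_cons.
exact: is_deriveD.
Qed.

(** Product rule in which the curve enters only through its value 1 and derivative [K] at 0; the
    right-hand factor contributes [adj K]. *)
Lemma cderive_trace_conj (R : realType) m (A B U K : 'M[R[i]]_m) (F : R -> 'M[R[i]]_m) :
  F 0 = 1%:M -> mderive F K ->
  cderive (fun t => \tr (A *m (F t *m U) *m B *m adj (F t *m U)))
    (\tr (A *m (K *m (U *m B *m adj U) + (U *m B *m adj U) *m adj K))).
Proof.
move=> F0 dF; apply: cderive_trace.
have dV := mderiveM dF (mderive_cst U).
have := mderiveM (mderiveM (mderiveM (mderive_cst A) dV) (mderive_cst B)) (mderive_adj dV).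
rewrite /= F0 !mulmx0 !mul0mx !addr0 add0r mul1mx adjM.
by rewrite mulmxDr !mulmxA.
Qed.

Theorem theorem9 (R : realType) (dL n : nat) (hdL : (0 < dL)%N)
    (U K : 'M[R[i]]_(dL ^ n)) :
  adj U *m U = 1%:M ->
  adj K = - K ->
  frob K = 1 ->
  let f := fun t : R => H2 (mexp (t%:C *: K) *m U) in
  derivable f 0 1 /\ `|derive1 f 0| <= 8 / Num.sqrt (dL ^ n)%N%:R.
Proof.
move=> uU _ K1 f; set r := Num.sqrt _.
have r0 : 0 < r by rewrite sqrtr_gt0 ltr0n expn_gt0 hdL.
have r2 : r ^+ 2 = (dL ^ n)%:R by rewrite sqr_sqrtr.
have fK : frob2 K = 1.
  by rewrite -[LHS]sqr_sqrtr ?frob2_ge0 // -/(frob K) K1 expr1n.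
pose label := ({ffun 'I_n -> 'I_dL} * {ffun 'I_n -> 'I_dL})%type.
pose B (b : label) := U *m Dop R b *m adj U.
pose z a b := \tr (adj (Dop R a) *m B b).
pose w a b := \tr (adj (Dop R a) *m (K *m B b + B b *m adj K)).
pose l (a b : label) := 4 * sqnorm (z a b) *
  (complex.Re (z a b) * complex.Re (w a b) + complex.Im (z a b) * complex.Im (w a b)).
pose c : R := ((dL ^ n)%N%:R ^+ 6)^-1.
have uB b : adj (B b) *m B b = 1%:M.
  rewrite !adjM adjK !mulmxA -(mulmxA _ (adj U)) uU mulmx1.
  by rewrite -(mulmxA U) Dop_unitary // mulmx1; exact: mulmx1C.
have dterm (a b : label) : is_derive (0 : R) (1 : R) (fun t =>
    complex.Re (`|\tr (adj (Dop R a) *m (mexp (t%:C *: K) *m U) *m Dop R b *m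
      adj (mexp (t%:C *: K) *m U))| ^+ 4)) (l a b).
  (* The exponential is abstracted to a curve [F], of which only the value and derivative at 0 are
     used. *)
  pose G (F : R -> 'M[R[i]]_(dL ^ n)) t :=
    \tr (adj (Dop R a) *m (F t *m U) *m Dop R b *m adj (F t *m U)).
  suff dG F : F 0 = 1%:M -> mderive F K ->
      is_derive (0 : R) (1 : R) (fun t => complex.Re (`|G F t| ^+ 4)) (l a b).
    by apply: dG (mderive_mexp K); rewrite rmorph0 scale0r mexp0.
  move=> F0 dF.
  have G0 : G F 0 = z a b by rewrite /G F0 mul1mx /z /B !mulmxA.
  have dGF : cderive (G F) (w a b) by exact: cderive_trace_conj.
  have := is_derive_sqnorm2 dGF; rewrite G0.
  rewrite (_ : (fun t => complex.Re _) =
    (fun t => (complex.Re (G F t) ^+ 2 + complex.Im (G F t) ^+ 2) ^+ 2)); first by [].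
  by apply/funext => t; rewrite (exprM _ 2 2) -add_Re2_Im2 -rmorphXn.
have df : is_derive (0 : R) (1 : R) f (0 - c * \sum_a \sum_b l a b).
  have dS := is_derive_real_sum (index_enum label)
    (fun a => is_derive_real_sum (index_enum label) (dterm a)).
  exact: (is_deriveB (is_derive_cst (1 : R) (0 : R) (1 : R)) (is_deriveZ c dS)).
split; first exact: ex_derive.
rewrite derive1E derive_val sub0r normrN normrM ger0_norm ?invr_ge0 ?exprn_ge0 //.
(* There are d^2 = r^4 labels. *)
have sum_cst (x : R) : \sum_(b : label) x = r ^+ 4 * x.
  by rewrite sumr_const card_prod card_ffun !card_ord -mulr_natl natrM -r2; ring.
have sum_le : `|\sum_a \sum_b l a b| <= 8 * r ^+ 11.
  (* The estimate [sum_deriv_bound] sums over a with b fixed, so b becomes the outer index. *)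
  rewrite exchange_big (le_trans (ler_norm_sum _ _ _)) //.
  apply: (@le_trans _ _ (\sum_(b : label) 8 * r ^+ 7)); last first.
    by rewrite sum_cst le_eqVlt; apply/orP; left; apply/eqP; ring.
  apply: ler_sum => b _; rewrite (le_trans (ler_norm_sum _ _ _)) //.
  exact: sum_deriv_bound.
apply: le_trans (ler_wpM2l _ sum_le) _; first by rewrite invr_ge0 exprn_ge0.
(* Here d^6 = r^12, so the bound 8 r^11 / r^12 equals 8 / r. *)
rewrite /c -r2 le_eqVlt; apply/orP; left; apply/eqP; field.
by rewrite gt_eqF.
Qed.
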